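(* Let $X$ be a real vector space, let $Y$ be a Banach space, and let $s\in\{1,-1\}$ be fixed. Suppose a mapping $f:X\to Y$ satisfies $f(0)=0$ and $\|D_f(x,y)\|\le\phi(x,y)$ for all $x,y\in X$, where $\phi:X\times X\to[0,\infty)$ is a mapping such that $$\sum_{i=0}^{\infty}\Big[(|s|+s)\,2^{4si}\,\phi\Big(0,\frac{x}{2^{si-1}}\Big)+(|s|-s)\,2^{3si}\,\phi\Big(0,\frac{x}{2^{si-1}}\Big)\Big]<\infty$$ and $$\lim_{n\to\infty}\Big[(|s|+s)\,2^{4sn-1}\,\phi\Big(\frac{x}{2^{sn}},\frac{y}{2^{sn}}\Big)+(|s|-s)\,2^{3sn}\,\phi\Big(\frac{x}{2^{sn}},\frac{y}{2^{sn}}\Big)\Big]=0$$ for all $x,y\in X$. Then there exist a unique quartic function $Q:X\to Y$ and a unique cubic function $C:X\to Y$ satisfying $$\|f(x)-Q(x)-C(x)\|\le\sum_{i=\frac{s-1}{2}}^{\infty}\Big\{\Big(\frac{2^{4s(i+1)}}{32}+\frac{2^{3s(i+1)}}{16}\Big)\Big[\phi\Big(0,\frac{x}{2^{s(i+1)}}\Big)+\phi\Big(0,\frac{-x}{2^{s(i+1)}}\Big)\Big]\Big\}$$ for all $x\in X$.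
   Context: For $f:X\to Y$, the difference operator $D_f:X\times X\to Y$ is $$D_f(x,y)=4[f(3x+y)+f(3x-y)]-12[f(2x+y)+f(2x-y)]+12[f(x+y)+f(x-y)]-f(2y)+8f(y)-30f(2x)+192f(x).$$ A function $Q:X\to Y$ is called quartic if $Q(x+2y)+Q(x-2y)=4(Q(x+y)+Q(x-y))+24Q(y)-6Q(x)$ for all $x,y\in X$. A function $C:X\to Y$ is called cubic if $C(2x+y)+C(2x-y)=2C(x+y)+2C(x-y)+12C(x)$ for all $x,y\in X$. *)

(* Defs.v *)
From HB Require Import structures.
From mathcomp Require Import all_boot all_order all_algebra.
From mathcomp Require Import all_classical all_reals all_analysis.

Set Implicit Arguments.
Unset Strict Implicit.
Unset Printing Implicit Defensive.

Import Order.TTheory GRing.Theory Num.Theory.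
Import numFieldNormedType.Exports.

Local Open Scope classical_set_scope.
Local Open Scope ring_scope.

Definition diff_op (R : realType) (X Y : lmodType R) (f : X -> Y) (x y : X) : Y :=
  4 *: (f (3 *: x + y) + f (3 *: x - y))
  - 12 *: (f (2 *: x + y) + f (2 *: x - y))
  + 12 *: (f (x + y) + f (x - y))
  - f (2 *: y) + 8 *: f y - 30 *: f (2 *: x) + 192 *: f x.

Definition quartic (R : realType) (X Y : lmodType R) (Q : X -> Y) : Prop :=
  forall x y : X,
    Q (x + 2 *: y) + Q (x - 2 *: y)
    = 4 *: (Q (x + y) + Q (x - y)) + 24 *: Q y - 6 *: Q x.

Definition cubic (R : realType) (X Y : lmodType R) (C : X -> Y) : Prop :=
  forall x y : X,
    C (2 *: x + y) + C (2 *: x - y)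
    = 2 *: C (x + y) + 2 *: C (x - y) + 12 *: C x.

(* The sum of u i over all integers i >= a, for nonnegative u; it is +oo
   when the series diverges. *)
Definition sum_from (R : realType) (a : int) (u : int -> R) : \bar R :=
  (\sum_(0 <= k <oo) (u (a + k%:Z)%R)%:E)%E.

(* Main.v *)
Require Import Defs.
From HB Require Import structures.
From mathcomp Require Import all_boot all_order all_algebra.
From mathcomp Require Import all_classical all_reals all_analysis.
From mathcomp Require Import ring.

Set Implicit Arguments.
Unset Strict Implicit.
Unset Printing Implicit Defensive.

Import Order.TTheory GRing.Theory Num.Theory.
Import numFieldNormedType.Exports.

Local Open Scope classical_set_scope.
Local Open Scope ring_scope.

(** As f(0) = 0, putting x = 0 in the difference operator leaves
D_f(0, y) = 12 f(y) + 4 f(-y) - f(2y), which is 16 g(y) - g(2y) on the even part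
g of f and 8 g(y) - g(2y) on its odd part.  So each part of f is nearly
homogeneous under doubling, of degree 4 for the even part and 3 for the odd one,
with an error controlled by phi(0, y) + phi(0, -y).  Hyers' direct method
(direct_method) then produces exactly homogeneous limits
Q(x) = lim a^n g(lam^n x), where lam = 1/2 and a = 16 (or 8) when s = 1, while
lam = 2 and a = 1/16 (or 1/8) when s = -1.  The telescoping error is the stated
series, and the vanishing limit of the rescaled phi gives D_Q = 0 and D_C = 0.

The algebraic core is that an even solution of D_Q = 0 is quartic and an odd
solution of D_C = 0 is cubic (even_diff_op_eq0_quartic,
odd_diff_op_eq0_cubic).  Let T be the shift by x.  For even Q the equation
says that (T + 1 + T^-1) applied to the central fourth difference of Q with step
x is the constant 72 Q(x).  Applying (T + 1 + T^-1)^3 to both sides turns the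
left side into the fourth difference with step 3x, since
T^3 - 1 = (T - 1)(T^2 + T + 1), and the right side into 24 * 81 Q(x).  At base
point 0 this gives Q(3x) = 81 Q(x), so the fourth difference with step 3x is
24 Q(3x); as 3x is arbitrary, Q is quartic.  The odd case is the same with the
difference (T - 1)^3 (T + 1) and the constant 12 * 27 C(x).

For uniqueness, the difference of two solutions splits by parity into a
quartic q and a cubic c, each bounded by twice the stated series.  Both are
homogeneous, so replacing x by lam^n x and rescaling bounds them by tails
of a convergent series (tail_dominated_eq0), hence they vanish. *)

(** * Linear identities in modules, by comparison of coefficients *)

(** Syntax of linear combinations: identities in a module are decided by comparing
    the scalar coefficients of each atom, which the ring tactics can do. *)
Inductive lincomb (K : Type) : Type :=
| LAtom of nat
| LZero
| LAdd of lincomb K & lincomb K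
| LOpp of lincomb K
| LScale of K & lincomb K.
Arguments LZero {K}.
Arguments LAtom {K}.

Section LinearCombinations.
Variables (K : pzRingType) (V : lmodType K).
Implicit Types (env : seq V) (t : lincomb K) (i : nat).

Fixpoint lin_eval env t : V :=
  match t with
  | LAtom i => env`_i
  | LZero => 0
  | LAdd t1 t2 => lin_eval env t1 + lin_eval env t2
  | LOpp t1 => - lin_eval env t1
  | LScale c t1 => c *: lin_eval env t1
  end.

Fixpoint lin_coef t i : K :=
  match t with
  | LAtom j => if eqn j i then 1 else 0
  | LZero => 0
  | LAdd t1 t2 => lin_coef t1 i + lin_coef t2 i
  | LOpp t1 => - lin_coef t1 i
  | LScale c t1 => c * lin_coef t1 i
  end.

Fixpoint same_coefs n t1 t2 : Prop :=
  if n is n'.+1 then lin_coef t1 n' = lin_coef t2 n' /\ same_coefs n' t1 t2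
  else True.

Lemma lin_evalE env t :
  lin_eval env t = \sum_(i < size env) lin_coef t i *: env`_i.
Proof.
elim: t => [j||t1 IH1 t2 IH2|t1 IH1|c t1 IH1] /=.
- case: (ltnP j (size env)) => hj.
    rewrite (bigD1 (Ordinal hj)) //= eqnE eqxx scale1r big1 ?addr0 // => i ne.
    rewrite ifF ?scale0r //; apply/negbTE; apply: contra ne => /eqP ji.
    by apply/eqP/val_inj.
  rewrite nth_default // big1 // => i _.
  by rewrite eqnE ifF ?scale0r // gtn_eqF // (leq_trans (ltn_ord i)).
- by rewrite big1 // => i _; rewrite scale0r.
- by rewrite IH1 IH2 -big_split /=; apply: eq_bigr => i _; rewrite scalerDl.
- by rewrite IH1 -sumrN; apply: eq_bigr => i _; rewrite scaleNr.
- by rewrite IH1 scaler_sumr; apply: eq_bigr => i _; rewrite scalerA.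
Qed.

Lemma eq_lin_eval env t1 t2 :
  same_coefs (size env) t1 t2 -> lin_eval env t1 = lin_eval env t2.
Proof.
rewrite !lin_evalE => h; apply: eq_bigr => -[i /= hi] _; congr (_ *: _).
elim: (size env) hi h => // n IH; rewrite ltnS leq_eqVlt => /orP[/eqP->|hi] /=.
  by case.
by case=> _; apply: IH.
Qed.

End LinearCombinations.

(* Atoms are compared up to unification: the same vector may occur with its zero
   or its operations inferred through different structures. *)
Ltac lin_mem x env :=
  match env with
  | nil => constr:(false)
  | cons ?y _ => let _ := match goal with _ => unify x y end in constr:(true)
  | cons _ ?env' => lin_mem x env'
  end.

Ltac lin_index x env :=
  match env with
  | cons ?y _ => let _ := match goal with _ => unify x y end in constr:(O)
  | cons _ ?env' => let n := lin_index x env' in constr:(S n)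
  end.

Ltac lin_env t env :=
  match t with
  | (?a + ?b)%R => let env' := lin_env a env in lin_env b env'
  | (- ?a)%R => lin_env a env
  | (_ *: ?a)%R => lin_env a env
  | 0%R => env
  | _ => match lin_mem t env with
         | true => env
         | false => constr:(cons t env)
         end
  end.

Ltac lin_quote K t env :=
  match t with
  | (?a + ?b)%R =>
      let a' := lin_quote K a env in
      let b' := lin_quote K b env in constr:(@LAdd K a' b')
  | (- ?a)%R => let a' := lin_quote K a env in constr:(@LOpp K a')
  | (?c *: ?a)%R => let a' := lin_quote K a env in constr:(@LScale K c a')
  | 0%R => constr:(@LZero K)
  | _ => let n := lin_index t env in constr:(@LAtom K n)
  end.

Ltac linear_identity K :=
  match goal with
  | |- @eq ?T ?a ?b =>
      let env0 := constr:(@nil T) in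
      let env1 := lin_env a env0 in
      let env := lin_env b env1 in
      let ta := lin_quote K a env in
      let tb := lin_quote K b env in
      apply: (@eq_lin_eval _ _ env ta tb);
      cbv [same_coefs size lin_coef eqn]; repeat split; by [ring | field]
  end.

(** * Differences along arithmetic progressions *)

Section Differences.
Variables (R : realType) (V : lmodType R).
Implicit Types (u : nat -> V) (q : V).

(** With T the shift of u, the hypothesis reads (T - 1)^4 (T^2 + T + 1) u = 72 q.
    Multiplying by (T^2 + T + 1)^3, of coefficients 1, 3, 6, 7, 6, 3, 1 and of
    sum 27, gives (T^3 - 1)^4 u = 27 * 72 q. *)
Lemma fourth_difference_trisection u q :
    (forall n, u n.+4.+2 - 3 *: u n.+4.+1 + 3 *: u n.+4 - 2 *: u n.+3
       + 3 *: u n.+2 - 3 *: u n.+1 + u n = 72 *: q) ->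
  u 12%N - 4 *: u 9%N + 6 *: u 6%N - 4 *: u 3%N + u 0%N = 24 *: (81 *: q).
Proof.
move=> h.
transitivity (72 *: q + 3 *: (72 *: q) + 6 *: (72 *: q) + 7 *: (72 *: q)
              + 6 *: (72 *: q) + 3 *: (72 *: q) + 72 *: q); last first.
  by linear_identity R.
rewrite -{1}(h 0%N) -{1}(h 1%N) -{1}(h 2%N) -{1}(h 3%N) -{1}(h 4%N) -{1}(h 5%N).
rewrite -(h 6%N).
by linear_identity R.
Qed.

(** Here the hypothesis reads (T - 1)^3 (T^3 + 1) u = 12 q; the multiplier
    (T^2 + T + 1)^3 yields (T^3 - 1)^3 (T^3 + 1) u = 27 * 12 q. *)
Lemma third_difference_trisection u q :
    (forall n, u n.+4.+2 - 3 *: u n.+4.+1 + 3 *: u n.+4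
       - 3 *: u n.+2 + 3 *: u n.+1 - u n = 12 *: q) ->
  u 12%N - 2 *: u 9%N + 2 *: u 3%N - u 0%N = 12 *: (27 *: q).
Proof.
move=> h.
transitivity (12 *: q + 3 *: (12 *: q) + 6 *: (12 *: q) + 7 *: (12 *: q)
              + 6 *: (12 *: q) + 3 *: (12 *: q) + 12 *: q); last first.
  by linear_identity R.
rewrite -{1}(h 0%N) -{1}(h 1%N) -{1}(h 2%N) -{1}(h 3%N) -{1}(h 4%N) -{1}(h 5%N).
rewrite -(h 6%N).
by linear_identity R.
Qed.

End Differences.

(** * Exact solutions: parity, homogeneity, and the quartic and cubic equations *)

Section DifferenceOperator.
Variables (R : realType) (X Y : lmodType R).
Implicit Types (g Q C : X -> Y) (x y : X).

Lemma diff_op0l g y : g 0 = 0 ->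
  diff_op g 0 y = 12 *: g y + 4 *: g (- y) - g (2 *: y).
Proof.
move=> g0; rewrite /diff_op !scaler0 !add0r !g0.
by linear_identity R.
Qed.

Lemma diff_op_eq0_at0 g : diff_op g 0 0 = 0 -> g 0 = 0.
Proof.
rewrite /diff_op !scaler0 !subr0 !add0r => h.
have : 177 *: g 0 = 0 by rewrite -[RHS]h; linear_identity R.
by move=> /eqP; rewrite scaler_eq0 pnatr_eq0 => /eqP.
Qed.

(** The equation only sees triples of consecutive fourth differences with step w;
    regrouping them gives a fourth difference with step 3w, which is no loss since
    every step is of the form 3w. *)
Lemma even_diff_op_eq0_quartic Q :
    (forall x, Q (- x) = Q x) -> (forall x y, diff_op Q x y = 0) -> quartic Q.
Proof.
move=> Qeven DQ.
have Q0 : Q 0 = 0 by apply: diff_op_eq0_at0.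
have Qdouble x : Q (2 *: x) = 16 *: Q x.
  have := DQ 0 x; rewrite diff_op0l // Qeven => /eqP.
  by rewrite subr_eq0 => /eqP <-; linear_identity R.
have trisect z w : Q (z + 2 *: (3 *: w)) - 4 *: Q (z + 3 *: w) + 6 *: Q z
    - 4 *: Q (z - 3 *: w) + Q (z - 2 *: (3 *: w)) = 24 *: (81 *: Q w).
  (* A progression of 13 terms centred at z: its terms 0, 3, 6, 9, 12 are the
     points of the fourth difference with step 3w. *)
  pose u k := Q (z - 6 *: w + k%:R *: w).
  rewrite -(@fourth_difference_trisection _ _ u (Q w)) /u.
    congr (Q _ - _ *: Q _ + _ *: Q _ - _ *: Q _ + Q _); linear_identity R.
  move=> n; pose c := z - 6 *: w + n.+3%:R *: w.
  rewrite (_ : z - 6 *: w + n.+4.+2%:R *: w = 3 *: w + c); last first.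
    by rewrite /c; linear_identity R.
  rewrite (_ : z - 6 *: w + n.+4.+1%:R *: w = 2 *: w + c); last first.
    by rewrite /c; linear_identity R.
  rewrite (_ : z - 6 *: w + n.+4%:R *: w = w + c); last first.
    by rewrite /c; linear_identity R.
  rewrite (_ : z - 6 *: w + n.+2%:R *: w = - (w - c)); last first.
    by rewrite /c; linear_identity R.
  rewrite (_ : z - 6 *: w + n.+1%:R *: w = - (2 *: w - c)); last first.
    by rewrite /c; linear_identity R.
  rewrite (_ : z - 6 *: w + n%:R *: w = - (3 *: w - c)); last first.
    by rewrite /c; linear_identity R.
  (* Four times the wanted relation is diff_op Q w c = 0, once Q (2 *: _) has
     been replaced by 16 *: Q _. *)
  rewrite -/c !Qeven; have := DQ w c; rewrite /diff_op !Qdouble => h.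
  transitivity (72 *: Q w + 4^-1 *: 0); last by linear_identity R.
  by rewrite -[in RHS]h; linear_identity R.
have Qtriple w : Q (3 *: w) = 81 *: Q w.
  have := trisect 0 w; rewrite !add0r !Qeven Qdouble Q0 => h.
  apply: (@scalerI _ _ 24); rewrite ?pnatr_eq0 // -h.
  by linear_identity R.
move=> x y; pose w := 3^-1 *: y.
have -> : y = 3 *: w by rewrite /w; linear_identity R.
have := trisect x w; rewrite -Qtriple => h.
by rewrite -h; linear_identity R.
Qed.

(** Same regrouping as in the even case, for the difference (T - 1)^3 (T + 1). *)
Lemma odd_diff_op_eq0_cubic C :
    (forall x, C (- x) = - C x) -> (forall x y, diff_op C x y = 0) -> cubic C.
Proof.
move=> Codd DC.
have C0 : C 0 = 0 by apply: diff_op_eq0_at0.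
have Cdouble x : C (2 *: x) = 8 *: C x.
  have := DC 0 x; rewrite diff_op0l // Codd => /eqP.
  by rewrite subr_eq0 => /eqP <-; linear_identity R.
have trisect z w : C (2 *: (3 *: w) + z) - 2 *: C (3 *: w + z)
    - 2 *: C (3 *: w - z) + C (2 *: (3 *: w) - z) = 12 *: (27 *: C w).
  pose u k := C (z - 6 *: w + k%:R *: w).
  rewrite -(@third_difference_trisection _ _ u (C w)) /u.
    rewrite (_ : z - 6 *: w + 3%:R *: w = - (3 *: w - z)); last first.
      by linear_identity R.
    rewrite (_ : z - 6 *: w + 0%:R *: w = - (2 *: (3 *: w) - z)); last first.
      by linear_identity R.
    rewrite (_ : z - 6 *: w + 9%:R *: w = 3 *: w + z); last first.
      by linear_identity R.
    rewrite (_ : z - 6 *: w + 12%:R *: w = 2 *: (3 *: w) + z); last first.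
      by linear_identity R.
    by rewrite !Codd; linear_identity R.
  move=> n; pose c := z - 6 *: w + n.+3%:R *: w.
  rewrite (_ : z - 6 *: w + n.+4.+2%:R *: w = 3 *: w + c); last first.
    by rewrite /c; linear_identity R.
  rewrite (_ : z - 6 *: w + n.+4.+1%:R *: w = 2 *: w + c); last first.
    by rewrite /c; linear_identity R.
  rewrite (_ : z - 6 *: w + n.+4%:R *: w = w + c); last first.
    by rewrite /c; linear_identity R.
  rewrite (_ : z - 6 *: w + n.+2%:R *: w = - (w - c)); last first.
    by rewrite /c; linear_identity R.
  rewrite (_ : z - 6 *: w + n.+1%:R *: w = - (2 *: w - c)); last first.
    by rewrite /c; linear_identity R.
  rewrite (_ : z - 6 *: w + n%:R *: w = - (3 *: w - c)); last first.
    by rewrite /c; linear_identity R.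
  rewrite -/c !Codd; have := DC w c; rewrite /diff_op !Cdouble => h.
  transitivity (12 *: C w + 4^-1 *: 0); last by linear_identity R.
  by rewrite -[in RHS]h; linear_identity R.
have Ctriple w : C (3 *: w) = 27 *: C w.
  have := trisect 0 w; rewrite !addr0 !subr0 !Cdouble => h.
  apply: (@scalerI _ _ 12); rewrite ?pnatr_eq0 // -h.
  by linear_identity R.
move=> x y; pose w := 3^-1 *: x.
have -> : x = 3 *: w by rewrite /w; linear_identity R.
have := trisect y w; rewrite -Ctriple => h.
by rewrite -h; linear_identity R.
Qed.

Lemma quartic0 Q : quartic Q -> Q 0 = 0.
Proof.
move=> hQ; have := hQ 0 0; rewrite scaler0 addr0 subr0 => h.
have : 24 *: Q 0 = 0.
  transitivity ((4 *: (Q 0 + Q 0) + 24 *: Q 0 - 6 *: Q 0) - (Q 0 + Q 0)).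
    by linear_identity R.
  by rewrite -h subrr.
by move=> /eqP; rewrite scaler_eq0 pnatr_eq0 => /eqP.
Qed.

Lemma quartic_even Q : quartic Q -> forall x, Q (- x) = Q x.
Proof.
move=> hQ x; have := hQ 0 x; have := hQ 0 (- x).
rewrite !add0r !scalerN !opprK (quartic0 hQ) => hN hP.
apply: (@scalerI _ _ 24); rewrite ?pnatr_eq0 //.
transitivity ((4 *: (Q (- x) + Q x) + 24 *: Q (- x) - 6 *: 0)
              - 4 *: (Q (- x) + Q x)); first by linear_identity R.
by rewrite -hN [Q (- _) + _]addrC hP; linear_identity R.
Qed.

Lemma quartic_double Q : quartic Q -> forall x, Q (2 *: x) = 16 *: Q x.
Proof.
move=> hQ x; have := hQ 0 x.
rewrite !add0r !(quartic_even hQ) (quartic0 hQ) => h.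
apply: (@scalerI _ _ 2); rewrite ?pnatr_eq0 //.
transitivity (Q (2 *: x) + Q (2 *: x)); first by linear_identity R.
by rewrite h; linear_identity R.
Qed.

Lemma cubic0 C : cubic C -> C 0 = 0.
Proof.
move=> hC; have := hC 0 0; rewrite scaler0 addr0 subr0 => h.
have : 14 *: C 0 = 0.
  transitivity ((2 *: C 0 + 2 *: C 0 + 12 *: C 0) - (C 0 + C 0)).
    by linear_identity R.
  by rewrite -h subrr.
by move=> /eqP; rewrite scaler_eq0 pnatr_eq0 => /eqP.
Qed.

Lemma cubic_odd C : cubic C -> forall x, C (- x) = - C x.
Proof.
move=> hC x; have := hC 0 x.
rewrite scaler0 !add0r (cubic0 hC) => h.
transitivity ((2 *: C x + 2 *: C (- x) + 12 *: 0) - C (- x) - 2 *: C x).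
  by linear_identity R.
by rewrite -h; linear_identity R.
Qed.

Lemma cubic_double C : cubic C -> forall x, C (2 *: x) = 8 *: C x.
Proof.
move=> hC x; have := hC x 0; rewrite !addr0 !subr0 => h.
apply: (@scalerI _ _ 2); rewrite ?pnatr_eq0 //.
transitivity (C (2 *: x) + C (2 *: x)); first by linear_identity R.
by rewrite h; linear_identity R.
Qed.

End DifferenceOperator.

(** * Even and odd parts *)

Section Parts.
Variables (R : realType) (X Y : lmodType R).
Implicit Types (f g : X -> Y) (x y : X).

Definition even_part f x : Y := 2^-1 *: (f x + f (- x)).
Definition odd_part f x : Y := 2^-1 *: (f x - f (- x)).

Lemma even_partN f x : even_part f (- x) = even_part f x.
Proof. by rewrite /even_part opprK addrC. Qed.

Lemma odd_partN f x : odd_part f (- x) = - odd_part f x.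
Proof. by rewrite /odd_part opprK; linear_identity R. Qed.

Lemma even_odd_part f x : f x = even_part f x + odd_part f x.
Proof. by rewrite /even_part /odd_part; linear_identity R. Qed.

Lemma diff_op_opp f x y :
  diff_op f (- x) (- y) = diff_op (fun z => f (- z)) x y.
Proof.
have oppZ k z : k *: - z = - (k *: z) by rewrite scalerN.
have oppB z : - z - - y = - (z - y) by rewrite opprD.
by rewrite /diff_op !oppZ !oppB -!opprD.
Qed.

Lemma diff_op_even_part f x y : diff_op (even_part f) x y =
  2^-1 *: (diff_op f x y + diff_op f (- x) (- y)).
Proof. by rewrite diff_op_opp /diff_op /even_part; linear_identity R. Qed.

Lemma diff_op_odd_part f x y : diff_op (odd_part f) x y =
  2^-1 *: (diff_op f x y - diff_op f (- x) (- y)).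
Proof. by rewrite diff_op_opp /diff_op /odd_part; linear_identity R. Qed.

Lemma diff_op_scale f (a c : R) x y :
  diff_op (fun z => a *: f (c *: z)) x y = a *: diff_op f (c *: x) (c *: y).
Proof.
have cD k : c *: (k *: x + y) = k *: (c *: x) + c *: y by linear_identity R.
have cB k : c *: (k *: x - y) = k *: (c *: x) - c *: y by linear_identity R.
have cM (k : R) (z : X) : c *: (k *: z) = k *: (c *: z) by linear_identity R.
rewrite /diff_op !cD !cB !cM (scalerBr c x y) (scalerDr c x y).
by linear_identity R.
Qed.

End Parts.

(** * The direct method *)

Section DirectMethod.
Variables (R : realType) (X : lmodType R) (Y : completeNormedModType R).
Implicit Types (lam a w : R) (f g G : X -> Y) (psi : X -> R).

Definition scaled_terms lam w psi (x : X) : R^nat :=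
  fun n => w ^+ n * psi (lam ^+ n *: x).

(** Hyers' method: the rescaled maps a^n g(lam^n x) move by at most
    a^n psi(lam^n x) at step n, so they form a Cauchy sequence whose total
    displacement is bounded by the series. *)
Lemma direct_method lam a g psi :
    0 <= a ->
    (forall x, `|g x - a *: g (lam *: x)| <= psi x) ->
    (forall x, cvgn (series (scaled_terms lam a psi x))) ->
  exists2 G : X -> Y,
    forall x, (fun n => a ^+ n *: g (lam ^+ n *: x)) @ \oo --> G x
  & forall x, `|g x - G x| <= limn (series (scaled_terms lam a psi x)).
Proof.
move=> a0 step summable.
pose v x n : Y := a ^+ n *: g (lam ^+ n *: x).
have psi0 x : 0 <= psi x by exact: le_trans (step x).
have vstep x n : `|telescope (v x) n| <= scaled_terms lam a psi x n.
  rewrite /telescope /= /v /scaled_terms distrC.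
  rewrite (_ : _ - _ = a ^+ n *: (g (lam ^+ n *: x)
                                   - a *: g (lam *: (lam ^+ n *: x)))).
    by rewrite normrZ ger0_norm ?exprn_ge0 // ler_wpM2l ?exprn_ge0.
  by rewrite scalerBr !scalerA -exprSr -exprS.
have nsummable x : cvgn [normed series (telescope (v x))].
  apply: series_le_cvg (vstep x) (summable x) => n //.
  by rewrite mulr_ge0 ?exprn_ge0.
have vE x : v x = cst (v x 0%N) + series (telescope (v x)).
  by apply/funext => n; rewrite telescopeK /= !fctE /= addrC subrK.
have v0 x : v x 0%N = g x by rewrite /v !expr0 !scale1r.
pose L x := limn (series (telescope (v x))).
exists (fun x => g x + L x) => x.
  rewrite -/(v x) vE v0; apply: cvgD; first exact: cvg_cst.
  exact: (normed_cvg (nsummable x)).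
rewrite opprD addNKr normrN.
apply: le_trans (lim_series_norm (nsummable x)) _.
by apply: lim_series_le; [exact: nsummable|exact: summable|exact: vstep].
Qed.

Lemma diff_op_cvg (u : nat -> X -> Y) G x y :
    (forall z, (fun n => u n z) @ \oo --> G z) ->
  (fun n => diff_op (u n) x y) @ \oo --> diff_op G x y.
Proof.
move=> uG; rewrite /diff_op.
by do ![apply: cvgD | apply: cvgN | apply: cvgZl_tmp | exact: uG].
Qed.

(** The difference operator commutes with rescaling, so on the rescaled maps it is
    at most a^n phi(lam^n x, lam^n y). *)
Lemma limit_diff_op_eq0 lam a g G (phi : X -> X -> R) :
    0 <= a ->
    (forall x y, `|diff_op g x y| <= phi x y) ->
    (forall x y, (fun n => a ^+ n * phi (lam ^+ n *: x) (lam ^+ n *: y))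
       @ \oo --> (0 : R)) ->
    (forall x, (fun n => a ^+ n *: g (lam ^+ n *: x)) @ \oo --> G x) ->
  forall x y, diff_op G x y = 0.
Proof.
move=> a0 gphi phi0 gG x y.
have lim1 := diff_op_cvg (x:=x) (y:=y) gG.
apply: (cvg_unique _ lim1) => //=.
apply/norm_cvg0P; apply: squeeze_cvgr (phi0 x y); last exact: cvg_cst.
near=> n; rewrite normr_ge0 /= diff_op_scale normrZ ger0_norm ?exprn_ge0 //.
by rewrite ler_wpM2l ?exprn_ge0.
Unshelve. all: by end_near. Qed.

Lemma series_scaled_termsS lam w psi x n :
  series (scaled_terms lam w psi x) n.+1 =
  psi x + w * series (scaled_terms lam w psi (lam *: x)) n.
Proof.
rewrite /series /= big_nat_recl // mulr_sumr /scaled_terms !expr0 mul1r scale1r.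
by congr (_ + _); apply: eq_bigr => i _; rewrite scalerA -exprSr exprS mulrA.
Qed.

(** Rescaling n times turns the bound by the sum of the series into a bound by its
    tail from rank n, because a <= w. *)
Lemma tail_dominated_eq0 lam a w (q : X -> Y) psi :
    0 <= a <= w ->
    (forall x, cvgn (series (scaled_terms lam w psi x))) ->
    (forall x, q x = a *: q (lam *: x)) ->
    (forall x, `|q x| <= limn (series (scaled_terms lam w psi x))) ->
  forall x, q x = 0.
Proof.
move=> /andP[a0 aw] summable qhom qle.
pose S x := series (scaled_terms lam w psi x); pose M x := limn (S x).
have Mrec x : M x = psi x + w * M (lam *: x).
  apply: (@cvg_lim _ (@Rhausdorff R)).
  rewrite -cvg_shiftS.
  rewrite (_ : [sequence S x n.+1]_n = cst (psi x) + w \*: S (lam *: x)).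
    by apply: cvgD; [exact: cvg_cst|apply: cvgZl_tmp; exact: summable].
  by apply/funext => n; rewrite /S /= series_scaled_termsS.
have tail n x : `|q x| <= M x - S x n.
  elim: n x => [x|n IH x].
    by rewrite /S /series /= big_geq // subr0; exact: qle.
  rewrite qhom normrZ ger0_norm // Mrec /S series_scaled_termsS opprD addrACA.
  rewrite subrr add0r -mulrBr.
  by apply: ler_pM.
move=> x; apply/normr0_eq0/eqP; rewrite eq_le normr_ge0 andbT.
rewrite -(subrr (M x)).
have Slim : (fun n => M x - S x n) @ \oo --> M x - M x.
  by apply: cvgB; [exact: cvg_cst|exact: summable].
by apply: (cvgr_to_ge Slim); apply: nearW => n; exact: tail.
Qed.

End DirectMethod.

(** * Sums over integers and real series *)

Section SumFrom.
Variables (R : realType) (a : int) (u : int -> R) (t : R^nat).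

Lemma sum_from_lim : (forall k, u (a + k%:Z) = t k) -> cvgn (series t) ->
  sum_from a u = (limn (series t))%:E.
Proof.
move=> ut tcvg; rewrite -EFin_lim //; congr (lim (_ @ \oo)).
apply/funext => n; rewrite /= -sumEFin.
by apply: eq_bigr => k _; rewrite ut.
Qed.

Lemma summable_of_sum_from (c : R) : 0 < c -> (forall k, 0 <= t k) ->
  (forall k, u (a + k%:Z) = c * t k) -> (sum_from a u < +oo)%E ->
  cvgn (series t).
Proof.
move=> c0 t0 ut; rewrite /sum_from.
under eq_eseriesr => k _ do rewrite ut.
move=> /nnseries_is_cvg ctcvg.
rewrite (_ : t = c^-1 *: (fun k => c * t k)).
  by apply: is_cvg_seriesZ; apply: ctcvg => k; rewrite mulr_ge0 // ltW.
by apply/funext => k; rewrite fctE /GRing.scale /= mulKf // gt_eqF.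
Qed.

End SumFrom.


(** * Stability for an abstract scaling factor *)

Section Stability.
Variables (R : realType) (X : lmodType R) (Y : completeNormedModType R).
Implicit Types (lam a w c : R) (f g Q C : X -> Y) (psi : X -> R).

Lemma summable_le lam a w psi x :
    0 <= a <= w -> (forall z, 0 <= psi z) ->
    cvgn (series (scaled_terms lam w psi x)) ->
  cvgn (series (scaled_terms lam a psi x)).
Proof.
move=> /andP[a0 aw] psi0; apply: series_le_cvg => n.
- by rewrite mulr_ge0 ?exprn_ge0.
- by rewrite mulr_ge0 ?exprn_ge0 // (le_trans a0).
- by rewrite ler_wpM2r // lerXn2r // nnegrE // (le_trans a0).
Qed.

(** The two scalings (halving and doubling) enter only through the factor lam, the
    inverse homogeneity factors a4 and a3 in degrees 4 and 3, and a weight w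
    that dominates both of them and for which the series converge. *)
Section Core.
Variables (lam w a4 a3 : R) (f : X -> Y) (phi : X -> X -> R).
Variables (psi4 psi3 : X -> R).
Hypotheses (a4_le : 0 <= a4 <= w) (a3_le : 0 <= a3 <= w).
Hypothesis phi_ge0 : forall x y, 0 <= phi x y.
Hypothesis f_phi : forall x y, `|diff_op f x y| <= phi x y.
Hypothesis phi_cvg0 : forall x y,
  (fun n => w ^+ n * phi (lam ^+ n *: x) (lam ^+ n *: y)) @ \oo --> (0 : R).
Hypothesis homogeneous4 : forall q : X -> Y,
  (forall x, q (2 *: x) = 16 *: q x) -> forall x, q x = a4 *: q (lam *: x).
Hypothesis homogeneous3 : forall q : X -> Y,
  (forall x, q (2 *: x) = 8 *: q x) -> forall x, q x = a3 *: q (lam *: x).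
Hypothesis even_step :
  forall x, `|even_part f x - a4 *: even_part f (lam *: x)| <= psi4 x.
Hypothesis odd_step :
  forall x, `|odd_part f x - a3 *: odd_part f (lam *: x)| <= psi3 x.
Hypothesis psi4N : forall x, psi4 (- x) = psi4 x.
Hypothesis psi3N : forall x, psi3 (- x) = psi3 x.
Hypothesis psi4_summable :
  forall x, cvgn (series (scaled_terms lam w psi4 x)).
Hypothesis psi3_summable :
  forall x, cvgn (series (scaled_terms lam w psi3 x)).

Definition stability_terms x : R^nat :=
  fun n => scaled_terms lam a4 psi4 x n + scaled_terms lam a3 psi3 x n.

Let B x : R := limn (series (stability_terms x)).

Let a4_ge0 : 0 <= a4. Proof. by case/andP: a4_le. Qed.
Let a3_ge0 : 0 <= a3. Proof. by case/andP: a3_le. Qed.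
Let psi4_ge0 x : 0 <= psi4 x. Proof. exact: le_trans (even_step x). Qed.
Let psi3_ge0 x : 0 <= psi3 x. Proof. exact: le_trans (odd_step x). Qed.

Let psi4_cvg x : cvgn (series (scaled_terms lam a4 psi4 x)).
Proof. exact: (summable_le a4_le). Qed.

Let psi3_cvg x : cvgn (series (scaled_terms lam a3 psi3 x)).
Proof. exact: (summable_le a3_le). Qed.

Lemma stability_terms_summable x : cvgn (series (stability_terms x)).
Proof. exact: is_cvg_seriesD. Qed.

Let BE x : B x = limn (series (scaled_terms lam a4 psi4 x))
                 + limn (series (scaled_terms lam a3 psi3 x)).
Proof. exact: lim_seriesD. Qed.

Let phi' x y := 2^-1 * (phi x y + phi (- x) (- y)).

Let phi'_ge0 x y : 0 <= phi' x y.
Proof. by rewrite mulr_ge0 ?invr_ge0 ?addr_ge0. Qed.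

Let phi'_cvg0 a : 0 <= a <= w -> forall x y,
  (fun n => a ^+ n * phi' (lam ^+ n *: x) (lam ^+ n *: y)) @ \oo --> (0 : R).
Proof.
move=> /andP[a0 aw] x y.
have upper : (fun n => 2^-1 * (w ^+ n * phi (lam ^+ n *: x) (lam ^+ n *: y)
    + w ^+ n * phi (lam ^+ n *: - x) (lam ^+ n *: - y))) @ \oo
    --> (2^-1 * (0 + 0) : R).
  by apply: cvgM; [exact: cvg_cst|apply: cvgD; exact: phi_cvg0].
rewrite addr0 mulr0 in upper; apply: squeeze_cvgr upper; last exact: cvg_cst.
apply: nearW => n /=; rewrite mulr_ge0 ?exprn_ge0 //=.
rewrite /phi' !scalerN -mulrDr mulrCA ler_pM2l ?invr_gt0 //.
by rewrite ler_wpM2r ?addr_ge0 // lerXn2r // nnegrE // (le_trans a0).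
Qed.

Lemma quartic_cubic_approximation :
  exists Q C : X -> Y,
    [/\ quartic Q, cubic C & forall x, `|f x - Q x - C x| <= B x].
Proof.
have [Q Qlim Qle] := direct_method a4_ge0 even_step psi4_cvg.
have [C Clim Cle] := direct_method a3_ge0 odd_step psi3_cvg.
have even_phi x y : `|diff_op (even_part f) x y| <= phi' x y.
  rewrite diff_op_even_part normrZ ger0_norm ?invr_ge0 // ler_pM2l ?invr_gt0 //.
  exact: le_trans (ler_normD _ _) (lerD _ _).
have odd_phi x y : `|diff_op (odd_part f) x y| <= phi' x y.
  rewrite diff_op_odd_part normrZ ger0_norm ?invr_ge0 // ler_pM2l ?invr_gt0 //.
  exact: le_trans (ler_normB _ _) (lerD _ _).
exists Q, C; split.
- apply: even_diff_op_eq0_quartic.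
    move=> x; apply: (cvg_unique _ (Qlim (- x))) => //.
    rewrite (_ : (fun n => _) = (fun n => a4 ^+ n *: even_part f (lam ^+ n *: x))).
      exact: Qlim.
    by apply/funext => n; rewrite scalerN even_partN.
  by apply: (limit_diff_op_eq0 a4_ge0 even_phi _ Qlim); exact: phi'_cvg0.
- apply: odd_diff_op_eq0_cubic.
    move=> x; apply: (cvg_unique _ (Clim (- x))) => //.
    rewrite (_ : (fun n => _) =
        - (fun n => a3 ^+ n *: odd_part f (lam ^+ n *: x))).
      exact: cvgN (Clim x).
    by apply/funext => n; rewrite fctE /= scalerN odd_partN scalerN.
  by apply: (limit_diff_op_eq0 a3_ge0 odd_phi _ Clim); exact: phi'_cvg0.
- move=> x; rewrite BE [f x]even_odd_part.
  rewrite -addrA -opprD opprD addrACA.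
  exact: le_trans (ler_normD _ _) (lerD (Qle x) (Cle x)).
Qed.

(** Taking even and odd parts of (Q' - Q) + (C' - C) separates the quartic from
    the cubic difference at no cost, since the bound is even; both are then
    bounded by a series with the common weight w. *)
Lemma quartic_cubic_unique Q C Q' C' :
    quartic Q -> cubic C -> quartic Q' -> cubic C' ->
    (forall x, `|f x - Q x - C x| <= B x) ->
    (forall x, `|f x - Q' x - C' x| <= B x) ->
  Q' = Q /\ C' = C.
Proof.
move=> hQ hC hQ' hC' QCle QCle'.
pose q x := Q' x - Q x; pose c x := C' x - C x.
have BN x : B (- x) = B x.
  by rewrite !BE /scaled_terms; congr (limn (series _) + limn (series _));
     apply/funext => n; rewrite scalerN ?psi4N ?psi3N.
have qcle x : `|q x + c x| <= 2 * B x.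
  rewrite (_ : q x + c x = (f x - Q x - C x) - (f x - Q' x - C' x)); last first.
    by rewrite /q /c; linear_identity R.
  rewrite mulr_natl mulr2n.
  exact: le_trans (ler_normB _ _) (lerD (QCle x) (QCle' x)).
have qN x : q (- x) = q x.
  by rewrite /q (quartic_even hQ) (quartic_even hQ').
have cN x : c (- x) = - c x.
  by rewrite /c (cubic_odd hC) (cubic_odd hC') opprD opprK.
have half_le (u v : Y) x : `|u| <= 2 * B x -> `|v| <= 2 * B x ->
    `|2^-1 *: (u + v)| <= 2 * B x.
  move=> ule vle; rewrite normrZ ger0_norm ?invr_ge0 //.
  rewrite ler_pdivrMl //; apply: le_trans (ler_normD _ _) _.
  by rewrite [2 * (_ * _)]mulr_natl mulr2n lerD.
pose psi x := 2 * (psi4 x + psi3 x).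
have psi_cvg x : cvgn (series (scaled_terms lam w psi x)).
  rewrite (_ : scaled_terms lam w psi x = 2 *:
      (scaled_terms lam w psi4 x + scaled_terms lam w psi3 x)).
    by apply: is_cvg_seriesZ; exact: is_cvg_seriesD.
  apply/funext => n; rewrite /scaled_terms /psi !fctE /= /GRing.scale /=.
  by rewrite -mulrDr mulrCA.
have Ble x : 2 * B x <= limn (series (scaled_terms lam w psi x)).
  have -> : 2 * B x = limn (series (2 *: stability_terms x)).
    exact/esym/lim_seriesZ/stability_terms_summable.
  apply: lim_series_le => [||n].
  - by apply: is_cvg_seriesZ; exact: stability_terms_summable.
  - exact: psi_cvg.
  rewrite /GRing.scale /= /stability_terms /scaled_terms /psi.
  rewrite [w ^+ n * _]mulrCA ler_pM2l // mulrDr.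
  case/andP: a4_le => _ a4w; case/andP: a3_le => _ a3w.
  by rewrite lerD // ler_wpM2r // lerXn2r // nnegrE // (le_trans a4_ge0).
split; apply/funext => x; apply/eqP; rewrite -subr_eq0; apply/eqP.
- rewrite -/(q x); apply: (tail_dominated_eq0 a4_le psi_cvg) x.
    apply: homogeneous4 => x.
    by rewrite /q (quartic_double hQ) (quartic_double hQ') scalerBr.
  move=> x; apply: le_trans (Ble x).
  rewrite (_ : q x = 2^-1 *: ((q x + c x) + (q (- x) + c (- x)))); last first.
    by rewrite qN cN; linear_identity R.
  by apply: half_le; rewrite ?qcle // -[B x]BN qcle.
- rewrite -/(c x); apply: (tail_dominated_eq0 a3_le psi_cvg) x.
    apply: homogeneous3 => x.
    by rewrite /c (cubic_double hC) (cubic_double hC') scalerBr.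
  move=> x; apply: le_trans (Ble x).
  rewrite (_ : c x = 2^-1 *: ((q x + c x) - (q (- x) + c (- x)))); last first.
    by rewrite qN cN; linear_identity R.
  by apply: half_le; rewrite ?normrN ?qcle // -[B x]BN qcle.
Qed.

Theorem quartic_cubic_stability (i0 : int) (u : X -> int -> R) :
    (forall x k, u x (i0 + k%:Z) = stability_terms x k) ->
  exists Q C : X -> Y,
    [/\ quartic Q, cubic C
      & forall x, (`|f x - Q x - C x|%R%:E <= sum_from i0 (u x))%E] /\
    forall Q' C' : X -> Y, quartic Q' -> cubic C' ->
      (forall x, (`|f x - Q' x - C' x|%R%:E <= sum_from i0 (u x))%E) ->
    Q' = Q /\ C' = C.
Proof.
move=> uE.
have sumE x : sum_from i0 (u x) = (B x)%:E.
  by rewrite (sum_from_lim (uE x)) //; exact: stability_terms_summable.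
have [Q [C [hQ hC QCle]]] := quartic_cubic_approximation.
exists Q, C; split; first by split=> // x; rewrite sumE lee_fin.
move=> Q' C' hQ' hC' QCle'; apply: quartic_cubic_unique => // x.
by have := QCle' x; rewrite sumE lee_fin.
Qed.

End Core.
End Stability.

(** * Approximate homogeneity under doubling *)

Section Steps.
Variables (R : realType) (X : lmodType R) (Y : normedModType R).
Variables (f : X -> Y) (phi : X -> X -> R).
Hypotheses (f0 : f 0 = 0) (f_phi : forall x y, `|diff_op f x y| <= phi x y).

Lemma even_part_double y :
  `|16 *: even_part f y - even_part f (2 *: y)| <=
  2^-1 * (phi 0 y + phi 0 (- y)).
Proof.
rewrite (_ : _ - _ = 2^-1 *: (diff_op f 0 y + diff_op f 0 (- y))).
  rewrite normrZ ger0_norm ?invr_ge0 // ler_pM2l ?invr_gt0 //.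
  exact: le_trans (ler_normD _ _) (lerD _ _).
by rewrite !diff_op0l // /even_part scalerN opprK; linear_identity R.
Qed.

Lemma odd_part_double y :
  `|8 *: odd_part f y - odd_part f (2 *: y)| <=
  2^-1 * (phi 0 y + phi 0 (- y)).
Proof.
rewrite (_ : _ - _ = 2^-1 *: (diff_op f 0 y - diff_op f 0 (- y))).
  rewrite normrZ ger0_norm ?invr_ge0 // ler_pM2l ?invr_gt0 //.
  exact: le_trans (ler_normB _ _) (lerD _ _).
by rewrite !diff_op0l // /odd_part scalerN opprK; linear_identity R.
Qed.

End Steps.

(** * Doubling and halving as scalings *)

Section Rescaling.
Variables (R : realType) (X : lmodType R) (Y : normedModType R).
Variables (k : R) (g : X -> Y) (psi : X -> R).
Hypothesis (k_gt0 : 0 < k).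

Lemma halving_step : (forall y, `|k *: g y - g (2 *: y)| <= psi y) ->
  forall x, `|g x - k *: g (2^-1 *: x)| <= psi (2^-1 *: x).
Proof.
move=> h x; rewrite distrC; apply: le_trans (h _).
by rewrite scalerA divff ?scale1r // pnatr_eq0.
Qed.

Lemma doubling_step : (forall y, `|k *: g y - g (2 *: y)| <= psi y) ->
  forall x, `|g x - k^-1 *: g (2 *: x)| <= k^-1 * psi x.
Proof.
move=> h x.
rewrite (_ : _ - _ = k^-1 *: (k *: g x - g (2 *: x))); last first.
  by rewrite scalerBr scalerA mulVf ?scale1r // gt_eqF.
by rewrite normrZ ger0_norm ?invr_ge0 ?(ltW k_gt0) // ler_pM2l ?invr_gt0.
Qed.

Lemma homogeneous_halving : (forall x, g (2 *: x) = k *: g x) ->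
  forall x, g x = k *: g (2^-1 *: x).
Proof. by move=> h x; rewrite -h scalerA divff ?scale1r // pnatr_eq0. Qed.

Lemma homogeneous_doubling : (forall x, g (2 *: x) = k *: g x) ->
  forall x, g x = k^-1 *: g (2 *: x).
Proof. by move=> h x; rewrite h scalerA mulVf ?scale1r // gt_eqF. Qed.

End Rescaling.

(** Summability is assumed at all points, so it survives replacing x by any
    multiple of x, in particular by -x; this absorbs the different arguments
    of phi in the hypothesis and in the bound. *)
Lemma symmetrized_summable (R : realType) (X : lmodType R) (lam w mu nu c : R)
    (phi0 : X -> R) : nu != 0 ->
    (forall x, cvgn (series (scaled_terms lam w (fun z => phi0 (nu *: z)) x))) ->
  forall x, cvgn (series (scaled_terms lam w
    (fun z => c * (phi0 (mu *: z) + phi0 (- (mu *: z)))) x)).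
Proof.
move=> nu0 h x; pose y := (mu / nu) *: x.
pose t := scaled_terms lam w (fun z => phi0 (nu *: z)).
rewrite (_ : scaled_terms _ _ _ _ = c *: (t y + t (- y))).
  by apply: is_cvg_seriesZ; apply: is_cvg_seriesD; exact: h.
apply/funext => n; transitivity (c * (t y n + t (- y) n)); last by [].
have E : nu *: (lam ^+ n *: y) = mu *: (lam ^+ n *: x).
  by rewrite /y !scalerA; congr (_ *: _); field.
by rewrite /t /scaled_terms !scalerN E -mulrDr mulrCA.
Qed.

Lemma expr2zM (R : realType) (m : int) (k : nat) :
  2 ^ (m * k%:Z) = (2 ^ m) ^+ k :> R.
Proof. by rewrite -exprz_exp. Qed.

(** * The mixed quartic-cubic equation *)

Theorem theorem3p3 (R : realType) (X : lmodType R) (Y : completeNormedModType R)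
    (s : int) (hs : s = 1 \/ s = -1)
    (f : X -> Y) (phi : X -> X -> R)
    (hphi : forall x y : X, 0 <= phi x y)
    (hf0 : f 0 = 0)
    (hf : forall x y : X, `|diff_op f x y| <= phi x y)
    (hsum : forall x : X,
      (sum_from 0%R (fun i : int =>
         (`|s| + s)%:~R * 2 ^ (4 * s * i) * phi 0 ((2 ^ (s * i - 1))^-1 *: x)
         + (`|s| - s)%:~R * 2 ^ (3 * s * i)
             * phi 0 ((2 ^ (s * i - 1))^-1 *: x))%R < +oo)%E)
    (hlim : forall x y : X,
      (fun n : nat =>
         (`|s| + s)%:~R * 2 ^ (4 * s * n%:Z - 1)
           * phi ((2 ^ (s * n%:Z))^-1 *: x) ((2 ^ (s * n%:Z))^-1 *: y)
         + (`|s| - s)%:~R * 2 ^ (3 * s * n%:Z)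
             * phi ((2 ^ (s * n%:Z))^-1 *: x) ((2 ^ (s * n%:Z))^-1 *: y))
        @ \oo --> (0 : R)) :
  let bound (Q C : X -> Y) :=
    forall x : X,
      (`|f x - Q x - C x|%R%:E <=
         sum_from ((s - 1) %/ 2)%Z (fun i : int =>
           (2 ^ (4 * s * (i + 1)) / 32 + 2 ^ (3 * s * (i + 1)) / 16)
           * (phi 0 ((2 ^ (s * (i + 1)))^-1 *: x)
              + phi 0 ((2 ^ (s * (i + 1)))^-1 *: (- x))))%R)%E in
  exists Q C : X -> Y,
    [/\ quartic Q, cubic C & bound Q C] /\
    forall Q' C' : X -> Y,
      quartic Q' -> cubic C' -> bound Q' C' -> Q' = Q /\ C' = C.
Proof.
pose Phi x := phi 0 x + phi 0 (- x).
have PhiN x : Phi (- x) = Phi x by rewrite /Phi opprK addrC.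
have even_dbl := even_part_double hf0 hf.
have odd_dbl := odd_part_double hf0 hf.
move=> bound; rewrite /bound {bound}.
case: hs hsum hlim => -> {s} sumC limC.
(* s = 1: halving, where the weight 16 of the quartic series also dominates the
   cubic one. *)
- have pow4 n : 2 ^ (4 * 1 * n%:Z) = 16 ^+ n :> R.
    by rewrite expr2zM mulr1; congr (_ ^+ n); rewrite -exprnP; ring.
  have pow3 n : 2 ^ (3 * 1 * n%:Z) = 8 ^+ n :> R.
    by rewrite expr2zM mulr1; congr (_ ^+ n); rewrite -exprnP; ring.
  have powN n : (2 ^ (1 * n%:Z))^-1 = 2^-1 ^+ n :> R.
    by rewrite mul1r -exprnP exprVn.
  have coef2 : (`|1| + 1 : int)%:~R = 2 :> R by [].
  have coef0 : (`|1| - 1 : int)%:~R = 0 :> R by [].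
  have summable : forall x, cvgn (series
      (scaled_terms 2^-1 16 (fun z => phi 0 (2 *: z)) x)).
    move=> x; apply: (summable_of_sum_from (c := 2)) (sumC x) => // k.
      by rewrite mulr_ge0 ?exprn_ge0.
    rewrite add0r coef2 coef0 !mul0r addr0 pow4 /scaled_terms -mulrA.
    congr (2 * (_ * phi 0 _)); rewrite scalerA expfzDr ?pnatr_eq0 //.
    by rewrite invfM powN mulrC; congr (_ * _ *: _); rewrite exprN1 invrK.
  have phi_cvg0 : forall x y, (fun n : nat => 16 ^+ n *
      phi (2^-1 ^+ n *: x) (2^-1 ^+ n *: y)) @ \oo --> (0 : R).
    move=> x y; apply: cvg_trans (limC x y).
    apply: near_eq_cvg; apply: nearW => n /=.
    rewrite coef2 coef0 !mul0r addr0 powN expfzDr ?pnatr_eq0 // pow4 exprN1.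
    by congr (_ * _); field.
  (* The doubling estimate is used at x / 2, which shifts the series by one
     index: its term of rank k carries 16^(k+1) / 32 and 8^(k+1) / 16. *)
  pose psi x := 2^-1 * Phi (2^-1 *: x).
  have psiN x : psi (- x) = psi x by rewrite /psi scalerN PhiN.
  have psi_summable : forall x, cvgn (series (scaled_terms 2^-1 16 psi x)).
    by apply: symmetrized_summable summable; rewrite pnatr_eq0.
  apply: (@quartic_cubic_stability _ _ _ 2^-1 16 16 8 f phi psi psi) => //.
  - by rewrite ler0n ler_nat.
  - by rewrite ler0n ler_nat.
  - by move=> q; apply: homogeneous_halving.
  - by move=> q; apply: homogeneous_halving.
  - exact: halving_step even_dbl.
  - exact: halving_step odd_dbl.
  move=> x k; rewrite /stability_terms /scaled_terms /psi /Phi.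
  rewrite (_ : _ + 1 = k.+1%:Z); last by rewrite [(_ %/ _)%Z]/= add0r -addn1.
  rewrite pow4 pow3 powN !scalerN !scalerA -exprS !exprS.
  by field.
(* s = -1: doubling, where the weight 1/8 of the cubic series also dominates the
   quartic one. *)
- have pow4 n : 2 ^ (4 * -1 * n%:Z) = 16^-1 ^+ n :> R.
    rewrite expr2zM mulrN1 -exprz_inv; congr (_ ^+ n).
    by rewrite -exprnP; field.
  have pow3 n : 2 ^ (3 * -1 * n%:Z) = 8^-1 ^+ n :> R.
    rewrite expr2zM mulrN1 -exprz_inv; congr (_ ^+ n).
    by rewrite -exprnP; field.
  have powN n : (2 ^ (-1 * n%:Z))^-1 = 2 ^+ n :> R.
    by rewrite mulN1r invr_expz opprK.
  have coef2 : (`|-1| - -1 : int)%:~R = 2 :> R by [].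
  have coef0 : (`|-1| + -1 : int)%:~R = 0 :> R by [].
  have summable : forall x, cvgn (series
      (scaled_terms 2 8^-1 (fun z => phi 0 (2 *: z)) x)).
    move=> x; apply: (summable_of_sum_from (c := 2)) (sumC x) => // k.
      by rewrite mulr_ge0 ?exprn_ge0 ?invr_ge0.
    rewrite add0r coef2 coef0 !mul0r add0r pow3 /scaled_terms -mulrA.
    congr (2 * (_ * phi 0 _)); rewrite scalerA expfzDr ?pnatr_eq0 //.
    by rewrite invfM powN mulrC; congr (_ * _ *: _); rewrite exprN1 invrK.
  have phi_cvg0 : forall x y, (fun n : nat => 8^-1 ^+ n *
      phi (2 ^+ n *: x) (2 ^+ n *: y)) @ \oo --> (0 : R).
    move=> x y; pose u n := 8^-1 ^+ n * phi (2 ^+ n *: x) (2 ^+ n *: y).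
    have double_lim : (fun n => 2 * u n) @ \oo --> (0 : R).
      apply: cvg_trans (limC x y); apply: near_eq_cvg; apply: nearW => n /=.
      by rewrite coef2 coef0 !mul0r add0r powN pow3 mulrA.
    have half_lim : (fun n => 2^-1 * (2 * u n)) @ \oo --> (2^-1 * 0 : R).
      by apply: cvgM double_lim; exact: cvg_cst.
    rewrite mulr0 in half_lim; apply: cvg_trans half_lim.
    by apply: near_eq_cvg; apply: nearW => n /=; rewrite mulKf ?pnatr_eq0.
  (* Written with 1 *: x so that symmetrized_summable applies with mu = 1. *)
  pose psi c x := c * Phi (1 *: x).
  have psiN c x : psi c (- x) = psi c x by rewrite /psi scalerN PhiN.
  have psi_summable c : forall x,
      cvgn (series (scaled_terms 2 8^-1 (psi c) x)).
    by apply: symmetrized_summable summable; rewrite pnatr_eq0.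
  apply: (@quartic_cubic_stability _ _ _ 2 8^-1 16^-1 8^-1 f phi
            (psi (16^-1 * 2^-1)) (psi (8^-1 * 2^-1))) => //.
  - by rewrite invr_ge0 ler0n lef_pV2 ?posrE // ler_nat.
  - by rewrite invr_ge0 ler0n lexx.
  - by move=> q; apply: homogeneous_doubling.
  - by move=> q; apply: homogeneous_doubling.
  - move=> x; rewrite /psi scale1r -mulrA.
    by apply: doubling_step even_dbl x.
  - move=> x; rewrite /psi scale1r -mulrA.
    by apply: doubling_step odd_dbl x.
  move=> x k; rewrite /stability_terms /scaled_terms /psi /Phi.
  rewrite (_ : _ + 1 = k%:Z); last by rewrite [(_ %/ _)%Z]/= addrAC addNr add0r.
  rewrite pow4 pow3 powN !scalerN !scale1r.
  by field.
Qed.
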